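(* Let $X,Y,Z$ be real reflexive Banach spaces, and let $A:X\to X'$, $b:X\times Y\to\mathbb R$, $J:X\times X\to\mathbb R$, $f\in Z'$, $\pi:X\to Z$, $\Lambda\subset Y$ be such that: (1) there exist a functional $h:X\to\mathbb R$ and a real number $r>1$ such that: $h(tw)=t^r h(w)$ for all $t>0$, $w\in X$; $(Av-Au,v-u)_{X',X}\ge h(v-u)$ for all $u,v\in X$; and whenever $u_n\rightharpoonup u$ in $X$, $h(u)\le\limsup h(u_n)$; (2) $A$ is continuous; (3) $(Au,u)_{X',X}/\|u\|_X\to\infty$ as $\|u\|_X\to\infty$; (4) $b$ is bilinear; $u_n\rightharpoonup u$ in $X$ implies $b(u_n,\mu)\to b(u,\mu)$ for all $\mu\in Y$; $\lambda_n\rightharpoonup\lambda$ in $Y$ implies $b(v,\lambda_n)\to b(v,\lambda)$ for all $v\in X$; and there is $\alpha>0$ with $\inf_{\mu\in Y,\mu\ne0}\sup_{v\in X,v\neq0}\frac{b(v,\mu)}{\|v\|_X\|\mu\|_Y}\ge\alpha$; (5) for every $u\in X$ the map $v\mapsto J(u,v)$ is positively homogeneous and subadditive on $X$; there is $c>0$ with $|J(u,v)|\le c\|v\|_X$ for all $u,v\in X$; and $u_n\rightharpoonup u$, $v_n\rightharpoonup v$ in $X$ imply $\limsup J(u_n,v_n)\le J(u,v)$; (6) $\Lambda$ is a closed convex bounded subset of $Y$ with $0_Y\in\Lambda$; (7) $\pi$ is linear and continuous; (8) there exist $M>0$ and $q\ge2$ such that $h(v)\ge M\|v\|_X^q$ for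 all $v\in X$ (with $h$ as in (1)); (9) there exists $m\ge0$ such that $J(w_1,w_2-w_1)+J(w_2,w_1-w_2)\le m\|w_1-w_2\|_X^q$ for all $w_1,w_2\in X$ (same $q$ as in (8)); (10) $M>m$; (11) $J(u,v)+J(u,-v)\le0$ for all $u,v\in X$. Then Problem (P) has a unique solution $(u,\lambda)\in X\times\Lambda$.
   Context: $(\cdot,\cdot)_{X',X}$ and $(\cdot,\cdot)_{Z',Z}$ denote the duality pairings between a space and its dual; $\rightharpoonup$ denotes weak convergence. Problem (P): find $u\in X$ and $\lambda\in\Lambda$ such that $$(Au,v-u)_{X',X}+b(v-u,\lambda)+J(u,v-u)\ge (f,\pi(v-u))_{Z',Z}\quad\text{for all }v\in X,$$ $$b(u,\mu-\lambda)\le 0\quad\text{for all }\mu\in\Lambda.$$ *)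

(* Defs.v *)
(* MathComp world (MathComp-Analysis), over an arbitrary realType R. *)
From HB Require Import structures.
From mathcomp Require Import all_boot all_order all_algebra.
From mathcomp Require Import all_classical all_reals all_analysis.
From mathcomp Require Import ring.

Set Implicit Arguments.
Unset Strict Implicit.
Unset Printing Implicit Defensive.

Import Order.TTheory GRing.Theory Num.Theory.
Import numFieldNormedType.Exports.

Local Open Scope classical_set_scope.
Local Open Scope ring_scope.

Section topological_dual.
Context {R : realType} (X : normedModType R).

Definition is_dual : {pred X -> R} :=
  mem [set f : X -> R | linear f /\ continuous f].

(* The topological dual X', with the operator norm (and its topology);
   the duality pairing (f, x)_{X',X} is the application f x. *)
Record dual := Dual { dual_fun :> X -> R ; dual_funP : dual_fun \in is_dual }.

HB.instance Definition _ := [isSub for dual_fun].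
HB.instance Definition _ := [Choice of dual by <:].

Lemma is_dual_submod_closed : submod_closed is_dual.
Proof.
split.
  rewrite inE; split; last by move=> x; exact: cvg_cst.
  by move=> a x y; rewrite [LHS]/= scaler0 addr0.
move=> a f g; rewrite !inE => -[lf cf] [lg cg]; split.
  move=> k x y; have fE := lf k x y; have gE := lg k x y.
  rewrite -[LHS]/(a * f (k *: x + y) + g (k *: x + y)).
  rewrite -[RHS]/(k * (a * f x + g x) + (a * f y + g y)) fE gE.
  rewrite -![_ *: _]/(_ * _); ring.
by move=> x; apply: cvgD; [apply: cvgMr; exact: cf|exact: cg].
Qed.

HB.instance Definition _ :=
  GRing.isSubmodClosed.Build R (X -> R) is_dual is_dual_submod_closed.
HB.instance Definition _ := [SubChoice_isSubLmodule of dual by <:].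

Lemma dual_linear (f : dual) : linear f.
Proof. by have := dual_funP f; rewrite inE => -[]. Qed.

Lemma dual_continuous (f : dual) : continuous f.
Proof. by have := dual_funP f; rewrite inE => -[]. Qed.

HB.instance Definition _ (f : dual) :=
  GRing.isLinear.Build R X R *:%R (dual_fun f) (dual_linear f).

Lemma dualDE (f g : dual) (x : X) : (f + g) x = f x + g x. Proof. by []. Qed.

Lemma dualZE (a : R) (f : dual) (x : X) : (a *: f) x = a * f x.
Proof. by []. Qed.

Definition dual_norm (f : dual) : R :=
  sup [set `|f x| | x in [set x : X | `|x| <= 1]].

Lemma dual_norm_has_sup (f : dual) :
  has_sup [set `|f x| | x in [set x : X | `|x| <= 1]].
Proof.
split; first by exists `|f 0|, 0 => //=; rewrite normr0.
have /linear_bounded_continuous/linear_boundedP : continuous (dual_fun f).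
  exact: dual_continuous.
move=> /pinfty_ex_gt0[M M0 fM]; exists M => _ [x /= x1 <-].
by rewrite (le_trans (fM x))// ger_pMr.
Qed.

Lemma dual_norm_ge0 (f : dual) : 0 <= dual_norm f.
Proof.
apply: le_trans (sup_upper_bound (dual_norm_has_sup f) _) => /=.
  exact: (normr_ge0 (f 0)).
by exists 0 => //=; rewrite normr0.
Qed.

Lemma dual_norm_le (f : dual) (x : X) : `|f x| <= dual_norm f * `|x|.
Proof.
have [->|x0] := eqVneq x 0; first by rewrite linear0 !normr0 mulr0.
rewrite -ler_pdivrMr ?normr_gt0//.
apply: (sup_upper_bound (dual_norm_has_sup f)) => /=.
exists (`|x|^-1 *: x) => /=.
  by rewrite normrZ normfV normr_id mulVf// normr_eq0.
by rewrite linearZ/= normrZ normfV normr_id mulrC.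
Qed.

Lemma dual_norm_ub (f : dual) (c : R) :
  (forall x, `|x| <= 1 -> `|f x| <= c) -> dual_norm f <= c.
Proof.
move=> fc; apply: ge_sup; first by case: (dual_norm_has_sup f).
by move=> _ [x x1 <-]; exact: fc.
Qed.

Lemma dual_normD (f g : dual) : dual_norm (f + g) <= dual_norm f + dual_norm g.
Proof.
apply: dual_norm_ub => x x1; rewrite dualDE.
rewrite (le_trans (ler_normD _ _))// lerD//.
- by apply: sup_upper_bound (dual_norm_has_sup f) _ _; exists x.
- by apply: sup_upper_bound (dual_norm_has_sup g) _ _; exists x.
Qed.

Lemma dual_normZ (a : R) (f : dual) : dual_norm (a *: f) = `|a| * dual_norm f.
Proof.
have le b g : dual_norm (b *: g) <= `|b| * dual_norm g.
  apply: dual_norm_ub => x x1; rewrite dualZE normrM.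
  rewrite ler_wpM2l//.
  by apply: sup_upper_bound (dual_norm_has_sup g) _ _; exists x.
apply/eqP; rewrite eq_le le/=.
have [->|a0] := eqVneq a 0; first by rewrite normr0 mul0r dual_norm_ge0.
rewrite -ler_pdivlMl ?normr_gt0// -normfV.
by rewrite -{1}(scale1r f) -(mulVf a0) -scalerA le.
Qed.

Lemma dual_norm0_eq0 (f : dual) : dual_norm f = 0 -> f = 0.
Proof.
move=> f0; apply/val_inj/funext => x /=.
by apply/eqP; rewrite -normr_le0 (le_trans (dual_norm_le f x))// f0 mul0r.
Qed.

HB.instance Definition _ :=
  Lmodule_isNormed.Build R dual dual_normD dual_normZ dual_norm0_eq0.

Lemma dual_normE (f : dual) : `|f| = dual_norm f. Proof. by []. Qed.

End topological_dual.

Section reflexivity.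
Context {R : realType} (X : normedModType R).

Definition bidual_eval (x : X) : dual X -> R := fun f => f x.

Lemma bidual_evalP (x : X) : bidual_eval x \in @is_dual R (dual X).
Proof.
rewrite inE; split=> //.
pose ev : {linear dual X -> R} := HB.pack (bidual_eval x)
  (GRing.isLinear.Build R (dual X) R *:%R (bidual_eval x)
     (fun a f g => erefl)).
rewrite -[bidual_eval x]/(ev : _ -> _).
apply: bounded_linear_continuous; apply/linear_boundedP.
near=> r => f; rewrite (le_trans (dual_norm_le f x))// mulrC.
apply: ler_wpM2r; first exact: dual_norm_ge0.
by near: r; apply: nbhs_pinfty_ge; rewrite num_real.
Unshelve. all: by end_near. Qed.

Definition bidual_embed (x : X) : dual (dual X) := Dual (bidual_evalP x).

Definition reflexive_space : Prop := range bidual_embed = setT.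

Definition weak_cvg (u : X^nat) (l : X) : Prop :=
  forall f : dual X, f \o u @ \oo --> f l.

End reflexivity.

Section hemivariational_problem.
Context {R : realType} {X Y Z : normedModType R}.

(* Taken in \bar R: the infimum over an empty index set (Y = 0) is +oo and the
   supremum over an empty one (X = 0) is -oo. *)
Definition infsup (b : X -> Y -> R) : \bar R :=
  ereal_inf [set ereal_sup
      [set (b v mu / (`|v| * `|mu|))%:E | v in [set v : X | v != 0]]
    | mu in [set mu : Y | mu != 0]].

(* (u, lambda) is a solution in X x Lambda of the mixed hemivariational
   problem. *)
Definition solves_P (A : X -> dual X) (b : X -> Y -> R) (J : X -> X -> R)
    (f : dual Z) (pi : X -> Z) (Lambda : set Y) (u : X) (lambda : Y) : Prop :=
  [/\ Lambda lambda,
      forall v : X, A u (v - u) + b (v - u) lambda + J u (v - u)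
                    >= f (pi (v - u))
    & forall mu : Y, Lambda mu -> b u (mu - lambda) <= 0].

End hemivariational_problem.

(* Main.v *)
Require Import Defs.
From HB Require Import structures.
From mathcomp Require Import all_boot all_order all_algebra finmap.
From mathcomp Require Import all_classical all_reals all_analysis.
From mathcomp Require Import ring lra.

(* By (11) and subadditivity each J u is linear, so Problem (P) says
   B u + b(., la) = 0 for B u = A u + J u - f o pi, together with b(u, .)
   maximal on Lambda at la. Thus (u, la) solves a variational inequality for
   (u, la) |-> (B u + b(., la), - b(u, .)), which is monotone because the terms
   in b cancel and B is strongly monotone by (8)-(10). Coercivity confines u to
   the interior of a ball. On ball x Lambda the inequality is solved by Minty's
   method: finitely many of the linear inequalities l q p >= 0 are solved
   approximately by a descent argument that uses only monotonicity, weak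
   compactness (limits along an ultrafilter, reflexivity and Mazur separation)
   gives a common solution p, and hemicontinuity of B turns it into a solution.
   Strong monotonicity gives uniqueness of u and the inf-sup condition that
   of la. *)

Set Implicit Arguments.
Unset Strict Implicit.
Unset Printing Implicit Defensive.

Import Order.TTheory GRing.Theory Num.Theory.
Import numFieldNormedType.Exports.

Local Open Scope classical_set_scope.
Local Open Scope ring_scope.

(** * Hahn-Banach theorem through maximal cones of constraints *)

Section hahn_banach.
Context {R : realType} {V : lmodType R}.
Variable p : V -> R.
Hypothesis p_subadd : forall x y, p (x + y) <= p x + p y.
Hypothesis p_hom : forall (t : R) x, 0 < t -> p (t *: x) = t * p x.

Let p0 : p 0 = 0.
Proof. have := @p_hom 2 0 (ltr0Sn _ 1); rewrite scaler0; lra. Qed.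

(* A pair (x, s) stands for the constraint s <= g x on a linear form g <= p. *)
Definition dominated_cone (C : set (V * R)) :=
  [/\ C (0, 0),
      forall x y s t, C (x, s) -> C (y, t) -> C (x + y, s + t),
      forall a x s, 0 < a -> C (x, s) -> C (a *: x, a * s)
    & forall x s, C (x, s) -> s <= p x].

(** Zorn's lemma: any two elements of the union of a chain lie in a common member, so the union of a
    nonempty chain of dominated cones is one too. *)
Lemma maximal_dominated_cone (C0 : set (V * R)) : dominated_cone C0 ->
  exists C, [/\ C0 `<=` C, dominated_cone C
    & forall D, C `<=` D -> dominated_cone D -> D `<=` C].
Proof.
move=> coneC0.
pose P C := C = set0 \/ (C0 `<=` C /\ dominated_cone C).
have [F FP totF|C [PC maxC]] := @Zorn_bigcup _ P.
  have [[B [FB B0]]|noB] := pselect (exists B, F B /\ B <> set0); last first.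
    left; rewrite -subset0 => x [B FB Bx]; apply: noB; exists B; split=> // B0.
    by rewrite B0 in Bx.
  have FPn D z : F D -> D z -> C0 `<=` D /\ dominated_cone D.
    by move=> FD Dz; have [D0|//] := FP _ FD; rewrite D0 in Dz.
  have [C0B [B00 _ _ _]] : C0 `<=` B /\ dominated_cone B.
    by have [/B0|] := FP _ FB.
  right; split; first by move=> z /C0B Bz; exists B.
  split.
  - by exists B.
  - move=> x y s t [D FD Dx] [E FE Ey].
    have [_ [_ addD _ _]] := FPn _ _ FD Dx.
    have [_ [_ addE _ _]] := FPn _ _ FE Ey.
    have [DE|ED] := totF _ _ FD FE.
      by exists E => //; apply: addE => //; exact: DE.
    by exists D => //; apply: addD => //; exact: ED.
  - move=> a x s a0 [D FD Dx]; have [_ [_ _ scD _]] := FPn _ _ FD Dx.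
    by exists D => //; exact: scD.
  - move=> x s [D FD Dx]; have [_ [_ _ _]] := FPn _ _ FD Dx.
    exact.
have [C00 _ _ _] := coneC0.
case: PC => [CE|[C0C coneC]].
  case: (maxC C0); last by right; split.
  by rewrite CE; split; [exact: sub0set|move=> /(_ _ C00)].
exists C; split=> // D CD coneD; apply: contrapT => DC; apply: (maxC D) => //.
by right; split=> //; exact: subset_trans CD.
Qed.

(** One-dimensional extension: subadditivity leaves room for a value [a] at [y] with
    [s - p (x - y) <= a <= p (x' + y) - s']. Adding the line through [(y, a)] keeps the cone
    dominated, so by maximality the line already lies in [C]. *)
Lemma maximal_dominated_cone_line (C : set (V * R)) : dominated_cone C ->
  (forall D, C `<=` D -> dominated_cone D -> D `<=` C) ->
  forall y, exists a, C (y, a) /\ C (- y, - a).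
Proof.
move=> [C0 Cadd Csc Cp] maxC y.
pose S := [set p (z.1 + y) - z.2 | z in C].
have lbS z : C z -> lbound S (z.2 - p (z.1 - y)).
  move=> Cz _ [w Cw <-]; case: z w Cz Cw => [x s] [x' s'] /= Cz Cw.
  have := Cp _ _ (Cadd _ _ _ _ Cz Cw).
  have := p_subadd (x - y) (x' + y); rewrite addrACA addNr addr0; lra.
have S0 : S !=set0 by exists (p (0 + y) - 0), (0, 0).
have lb : has_lbound S by exists (0 - p (0 - y)); exact: (lbS (0, 0)).
pose a := inf S.
have a_le x s : C (x, s) -> s + a <= p (x + y).
  move=> Cxs; rewrite addrC -lerBrDr; apply: ge_inf => //.
  by exists (x, s).
have a_ge x s : C (x, s) -> s - a <= p (x - y).
  move=> Cxs; rewrite lerBlDr addrC -lerBlDr.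
  exact: lb_le_inf (lbS (x, s) _).
pose D := [set z : V * R |
  exists x s t, C (x, s) /\ z = (x + t *: y, s + t * a)].
have DC : D `<=` C.
  apply: maxC.
    by move=> [x s] Cxs; exists x, s, 0; rewrite scale0r mul0r !addr0.
  split.
  - by exists 0, 0, 0; rewrite scale0r mul0r !addr0.
  - move=> _ _ _ _ [x [s [t [Cxs [-> ->]]]]] [x' [s' [t' [Cxs' [-> ->]]]]].
    exists (x + x'), (s + s'), (t + t'); split; first exact: Cadd.
    by rewrite scalerDl mulrDl addrACA (addrACA s).
  - move=> k _ _ k0 [x [s [t [Cxs [-> ->]]]]].
    exists (k *: x), (k * s), (k * t); split; first exact: Csc.
    by rewrite scalerDr mulrDr scalerA mulrA.
  - move=> _ _ [x [s [t [Cxs [-> ->]]]]].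
    (* Dividing by the absolute value of [t] reduces to [t = -1] and [t = 1], which are [a_ge] and
       [a_le]. *)
    have [t0|t0|->] := ltgtP t 0;
      last by rewrite scale0r mul0r !addr0; exact: Cp.
    + have nt : 0 < - t by rewrite oppr_gt0.
      have tV : 0 < (- t)^-1 by rewrite invr_gt0.
      have -> : x + t *: y = (- t) *: ((- t)^-1 *: x - y).
        by rewrite scalerBr scalerA divff ?gt_eqF// scale1r scaleNr opprK.
      rewrite p_hom// -ler_pdivrMl//; have := a_ge _ _ (Csc _ _ _ tV Cxs).
      suff -> : (- t)^-1 * (s + t * a) = (- t)^-1 * s - a by [].
      by field; rewrite lt_eqF.
    + have tV : 0 < t^-1 by rewrite invr_gt0.
      have -> : x + t *: y = t *: (t^-1 *: x + y).
        by rewrite scalerDr scalerA divff ?gt_eqF// scale1r.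
      rewrite p_hom// -ler_pdivrMl//; have := a_le _ _ (Csc _ _ _ tV Cxs).
      by rewrite mulrDr mulrA mulVf ?gt_eqF// mul1r.
exists a; split; apply: DC.
  by exists 0, 0, 1; rewrite scale1r mul1r !add0r.
by exists 0, 0, (-1); rewrite scaleN1r mulN1r !add0r.
Qed.

(** In a maximal cone the [a] with both [(y, a)] and [(- y, - a)] in [C] is unique because
    [p 0 = 0]; the closure properties of the cone make it linear in [y]. *)
Lemma hahn_banach_cone (C0 : set (V * R)) : dominated_cone C0 ->
  exists g : V -> R, [/\ linear g, forall x, g x <= p x
    & forall x s, C0 (x, s) -> s <= g x].
Proof.
move=> /maximal_dominated_cone[C [C0C coneC maxC]].
have [C00 Cadd Csc Cp] := coneC.
have [g gP] := choice (maximal_dominated_cone_line coneC maxC).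
have le_g x s : C (x, s) -> s <= g x.
  move=> Cxs; have [_ Ng] := gP x; have := Cp _ _ (Cadd _ _ _ _ Cxs Ng).
  by rewrite subrr p0 subr_le0.
have ge_g x s : C (- x, - s) -> g x <= s.
  move=> Cxs; have [Cg _] := gP x; have := Cp _ _ (Cadd _ _ _ _ Cg Cxs).
  by rewrite subrr p0 subr_le0.
have gE x s : C (x, s) -> C (- x, - s) -> g x = s.
  by move=> C1 C2; apply/eqP; rewrite eq_le ge_g//= le_g.
have gD x y : g (x + y) = g x + g y.
  have [x1 x2] := gP x; have [y1 y2] := gP y.
  by apply: gE; [exact: Cadd|rewrite !opprD; exact: Cadd].
have gZ0 a x : 0 < a -> g (a *: x) = a * g x.
  move=> a0; have [x1 x2] := gP x.
  by apply: gE; [exact: Csc|rewrite -scalerN -mulrN; exact: Csc].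
have gN x : g (- x) = - g x.
  by have [x1 x2] := gP x; apply: gE => //; rewrite !opprK.
have gZ a x : g (a *: x) = a * g x.
  have [a0|a0|->] := ltgtP a 0.
  - by rewrite -[a *: x]opprK -scaleNr gN gZ0 ?oppr_gt0// mulNr opprK.
  - exact: gZ0.
  - by rewrite scale0r mul0r; apply: gE; rewrite // !oppr0.
exists g; split.
- by move=> a x y; rewrite gD gZ.
- by move=> x; apply: Cp; case: (gP x).
- by move=> x s /C0C /le_g.
Qed.

End hahn_banach.

(** * Continuous functionals, convex combinations and Mazur separation *)

Section dual_space.
Context {R : realType}.

Lemma bounded_is_dual (V : normedModType R) (g : V -> R) (C : R) :
  linear g -> (forall x, `|g x| <= C * `|x|) -> g \in @is_dual R V.
Proof.
move=> lg gC; rewrite inE; split=> //.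
pose G : {linear V -> R} := HB.pack g (GRing.isLinear.Build R V R *:%R g lg).
rewrite -[g]/(G : _ -> _).
apply: bounded_linear_continuous; apply/linear_boundedP.
exists C; split=> [|r Cr x]; first exact: num_real.
by rewrite (le_trans (gC x))// ler_wpM2r// ltW.
Qed.

Lemma convex_setP (V : lmodType R) (K : set V) : convex_set K ->
  forall x y (t : R), K x -> K y -> 0 <= t <= 1 -> K (t *: x + (1 - t) *: y).
Proof.
move=> cK x y t Kx Ky /andP[t0 t1].
by have /set_mem := cK x y (Itv01 t0 t1) (mem_set Kx) (mem_set Ky).
Qed.

Definition affine_on (V : lmodType R) (K : set V) (g : V -> R) :=
  forall x y t, K x -> K y -> 0 <= t <= 1 ->
    g (t *: x + (1 - t) *: y) = t * g x + (1 - t) * g y.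

(** The weights are left unnormalised so that total weight 0, where any point of [K] serves, is
    covered. One [z] works for all affine [g]. *)
Lemma convex_comb2 (V : lmodType R) (K : set V) (x y : V) (s t : R) :
  convex_set K -> K x -> K y -> 0 <= s -> 0 <= t ->
  exists z, [/\ K z, s *: x + t *: y = (s + t) *: z
    & forall g, affine_on K g -> s * g x + t * g y = (s + t) * g z].
Proof.
move=> cK Kx Ky s0 t0; have [st0|st0] := eqVneq (s + t) 0.
  have [-> ->] : s = 0 /\ t = 0 by split; lra.
  exists x; split=> // [|g _]; first by rewrite !(addr0, scale0r).
  by rewrite !(addr0, mul0r).
have s1 : 0 <= s / (s + t) <= 1.
  rewrite divr_ge0 ?addr_ge0//= ler_pdivrMr ?mul1r ?lerDl//.
  by rewrite lt_def st0 addr_ge0.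
have sE : (s + t) * (s / (s + t)) = s by field.
have tE : (s + t) * (1 - s / (s + t)) = t by field.
exists ((s / (s + t)) *: x + (1 - s / (s + t)) *: y); split.
- exact: convex_setP.
- by rewrite scalerDr !scalerA sE tE.
- by move=> g ->//; rewrite mulrDr (mulrA (s + t)) sE (mulrA (s + t)) tE.
Qed.

Lemma convex_comb (V : lmodType R) (K : set V) (s : seq V) (w : V -> R) :
  convex_set K -> K !=set0 -> (forall k, 0 <= w k) ->
  (forall k, k \in s -> K k) ->
  exists2 z, K z & forall g, affine_on K g ->
    \sum_(k <- s) w k * g k = (\sum_(k <- s) w k) * g z.
Proof.
move=> cK [k0 Kk0] w0; elim: s => [_|k s IH sK].
  by exists k0 => // g _; rewrite !big_nil mul0r.
have [|z Kz zE] := IH; first by move=> l ls; apply: sK; rewrite inE ls orbT.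
have Kk : K k by apply: sK; rewrite mem_head.
have W0 : 0 <= \sum_(l <- s) w l by apply: sumr_ge0.
have [y [Ky _ yE]] := convex_comb2 cK Kk Kz (w0 k) W0.
by exists y => // g ag; rewrite !big_cons zE// yE.
Qed.

(** The cone spanned by the [(k - x0, d)]: a linear form below the norm that obeys these constraints
    separates [x0] from [K] with gap [d]. *)
Lemma dominated_cone_separation (V : normedModType R) (K : set V) (x0 : V)
    (d : R) : convex_set K -> K !=set0 -> (forall k, K k -> d <= `|k - x0|) ->
  dominated_cone (fun x : V => `|x|) [set z |
    exists t k, [/\ 0 <= t, K k & z = (t *: (k - x0), t * d)]].
Proof.
move=> cK [k0 Kk0] Kd; split.
- by exists 0, k0; rewrite scale0r mul0r.
- move=> _ _ _ _ [t [k [t0 Kk [-> ->]]]] [u [l [u0 Kl [-> ->]]]].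
  have [m [Km mE _]] := convex_comb2 cK Kk Kl t0 u0.
  exists (t + u), m; split; [exact: addr_ge0|exact: Km|].
  by rewrite -mulrDl !scalerBr -mE scalerDl opprD addrACA.
- move=> a _ _ a0 [t [k [t0 Kk [-> ->]]]].
  by exists (a * t), k; rewrite scalerA mulrA mulr_ge0// ltW.
- move=> _ _ [t [k [t0 Kk [-> ->]]]].
  by rewrite normrZ ger0_norm// ler_wpM2l// Kd.
Qed.

(** Here [d] is the radius of a ball around [x0] that misses [K]; domination by the norm makes the
    Hahn-Banach form continuous. *)
Lemma mazur_separation (V : normedModType R) (K : set V) (x0 : V) :
  closed K -> convex_set K -> K !=set0 -> ~ K x0 ->
  exists (g : dual V) (d : R), 0 < d /\ forall k, K k -> g x0 + d <= g k.
Proof.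
move=> clK cK K0 Kx0.
have /nbhs_ballP[d /= d0 dK] : nbhs x0 (~` K).
  by apply: open_nbhs_nbhs; split=> //; exact: closed_openC.
have Kd k : K k -> d <= `|k - x0|.
  move=> Kk; rewrite leNgt; apply/negP => kd; apply: (dK k) => //.
  by rewrite -ball_normE /ball_ /= distrC.
have hom (t : R) (x : V) : 0 < t -> `|t *: x| = t * `|x|.
  by move=> t0; rewrite normrZ gtr0_norm.
have [g [lg gle gK]] := hahn_banach_cone (@ler_normD _ V) hom
  (dominated_cone_separation cK K0 Kd).
have g_dual : g \in @is_dual R V.
  apply: (@bounded_is_dual _ _ 1) => // x; rewrite mul1r ler_norml gle andbT.
  have gN : g (- x) = - g x.
    have g0 : g 0 = 0 by have := lg (-1) 0 0; rewrite !scaleN1r !addNr.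
    by have := lg (-1) x 0; rewrite g0 !scaleN1r !addr0.
  by rewrite lerNl -gN (le_trans (gle _))// normrN.
exists (Dual g_dual), d; split=> // k Kk.
have : d <= g (k - x0) by apply: gK; exists 1, k; rewrite scale1r mul1r.
have -> : g (k - x0) = g k - g x0.
  by rewrite -[LHS]/(Dual g_dual (k - x0)) linearB.
by rewrite /=; lra.
Qed.

End dual_space.

(** * Weak compactness in reflexive spaces, along ultrafilters *)

Section weak_compactness.
Context {R : realType}.

(** A compact segment provides a cluster point, and an ultrafilter converges to its cluster
    points. *)
Lemma ultra_bounded_cvg T (F : set_system T) (g : T -> R) (C : R) :
  UltraFilter F -> (\forall t \near F, `|g t| <= C) ->
  exists l : R, g @ F --> l.
Proof.
move=> UF gC.
have [|l [_ gl]] := @segment_compact R (- C) C (g @ F) _.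
  by apply: filterS gC => t; rewrite ler_norml /= in_itv.
exists l => U lU; have [//|FnU] := in_ultra_setVsetC (g @^-1` U) UF.
by have [y [/= nUy]] := gl (~` U) U FnU lU.
Qed.

(** The limits of [phi (x t)] define a bounded linear form in [phi], which reflexivity represents by
    a point. *)
Lemma reflexive_ultra_weak_cvg (V : normedModType R) T (F : set_system T)
    (x : T -> V) (C : R) : reflexive_space V -> UltraFilter F ->
  (\forall t \near F, `|x t| <= C) ->
  exists l : V, forall phi : dual V, phi (x t) @[t --> F] --> phi l.
Proof.
move=> reflV UF xC.
have phiC (phi : dual V) : \forall t \near F, `|phi (x t)| <= C * `|phi|.
  apply: filterS xC => t xtC; rewrite (le_trans (dual_norm_le _ _))// mulrC.
  by rewrite ler_wpM2r// dual_norm_ge0.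
have [L LP] := choice (fun phi => ultra_bounded_cvg UF (phiC phi)).
have L_dual : L \in @is_dual R (dual V).
  apply: (@bounded_is_dual _ _ _ C) => [a phi psi|phi].
    apply: (cvg_unique _ (LP _)); first exact: norm_hausdorff.
    by apply: cvgD (LP psi); apply: cvgMl_tmp; exact: LP.
  by apply: cvgr_to_le (cvg_norm (LP phi)) (phiC phi).
have [l _ lL] : range (@bidual_embed R V) (Dual L_dual) by rewrite reflV.
exists l => phi; suff -> : phi l = L phi by [].
by rewrite -[phi l]/(bidual_embed l phi) lL.
Qed.

(** A functional separating [l] from [K] by a positive gap would contradict its own convergence. *)
Lemma closed_convex_weak_cvg (V : normedModType R) (K : set V) T
    (F : set_system T) (x : T -> V) (l : V) : ProperFilter F ->
  closed K -> convex_set K -> (\forall t \near F, K (x t)) ->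
  (forall phi : dual V, phi (x t) @[t --> F] --> phi l) -> K l.
Proof.
move=> PF clK cK xK xl; apply: contrapT => Kl.
have [t Kxt] := filter_ex xK.
have [|g [d [d0 gK]]] := mazur_separation clK cK _ Kl; first by exists (x t).
have : g l + d <= g l by apply: cvgr_to_ge (xl g) _; apply: filterS xK => s /gK.
by rewrite gerDl leNgt d0.
Qed.

End weak_compactness.

(** * Finite systems of monotone affine inequalities *)

Section approximate_minty.
Context {R : realType} {V : lmodType R}.
Variables (K : set V) (l : V -> V -> R).
Hypothesis K_convex : convex_set K.
Hypothesis K0 : K !=set0.
Hypothesis l_affine : forall q, K q -> affine_on K (l q).
Hypothesis l_mono : forall q x, K q -> K x -> 0 <= l q x + l x q.
Hypothesis l_bounded : forall q, K q ->
  exists D : R, forall x, K x -> `|l q x| <= D.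

(** The negative part: [neg (l q x)] is the violation of [0 <= l q x]. *)
Let neg (a : R) := Num.max 0 (- a).

Let neg_ge0 a : 0 <= neg a. Proof. by rewrite le_max lexx. Qed.

Let negM a : neg a * a = - neg a ^+ 2.
Proof. by rewrite /neg; case: ltP => _; ring. Qed.

Let negD a b : neg (a + b) ^+ 2 <= (neg a - b) ^+ 2.
Proof.
rewrite -[leRHS]ger0_norm ?sqr_ge0// normrX ler_sqr ?nnegrE ?normr_ge0//.
rewrite ge_max normr_ge0/= opprD (le_trans _ (ler_norm _))// lerD2r.
by rewrite le_max lexx orbT.
Qed.

Let oscillation_bound (s : seq V) : (forall q, q \in s -> K q) ->
  exists D : R, forall x y, K x -> K y ->
    \sum_(q <- s) (l q y - l q x) ^+ 2 <= D.
Proof.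
elim: s => [_|q s IH sK]; first by exists 0 => x y _ _; rewrite big_nil.
have [|D HD] := IH; first by move=> p ps; apply: sK; rewrite inE ps orbT.
have [E HE] := l_bounded (sK _ (mem_head _ _)).
exists ((E + E) ^+ 2 + D) => x y Kx Ky; rewrite big_cons lerD ?HD//.
have E0 : 0 <= E := le_trans (normr_ge0 _) (HE _ Kx).
rewrite -[leLHS]ger0_norm ?sqr_ge0// normrX ler_sqr ?nnegrE ?addr_ge0//.
by rewrite (le_trans (ler_normB _ _))// lerD ?HE.
Qed.

Let defect (s : seq V) x := \sum_(q <- s) neg (l q x) ^+ 2.

(** The step goes towards the barycentre [z] of [s] weighted by the violations. Each [l q] varies
    affinely along it, so the defect is bounded by a quadratic in [t] whose slope at 0 is at most
    [- 2 * defect s x]. *)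
Let defect_descent (s : seq V) (D : R) : (forall q, q \in s -> K q) ->
  (forall x y, K x -> K y -> \sum_(q <- s) (l q y - l q x) ^+ 2 <= D) ->
  forall x t, K x -> 0 <= t <= 1 -> exists2 y, K y &
    defect s y <= defect s x - 2 * t * defect s x + t ^+ 2 * D.
Proof.
move=> sK sD x t Kx t01; pose w q := neg (l q x).
have [z Kz zE] := @convex_comb _ _ _ _ w K_convex K0 (fun=> neg_ge0 _) sK.
exists (t *: z + (1 - t) *: x); first exact: convex_setP.
(* Multiplied by the total weight, this is the double sum of [w q * w p * l q p], nonnegative after
   symmetrisation by [l_mono]. *)
have wz : 0 <= \sum_(q <- s) w q * l q z.
  have [W0|W0] := eqVneq (\sum_(q <- s) w q) 0.
    rewrite big_seq big1// => q qs; suff -> : w q = 0 by rewrite mul0r.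
    move: W0 => /eqP; rewrite psumr_eq0; last by move=> *; exact: neg_ge0.
    by move=> /allP/(_ _ qs)/eqP.
  have Wgt0 : 0 < \sum_(q <- s) w q.
    by rewrite lt_def W0 sumr_ge0// => *; exact: neg_ge0.
  rewrite -(pmulr_rge0 _ Wgt0) mulr_sumr.
  have -> : \sum_(q <- s) (\sum_(q <- s) w q) * (w q * l q z) =
            \sum_(q <- s) \sum_(p <- s) w q * w p * l q p.
    rewrite big_seq [RHS]big_seq; apply: eq_bigr => q /sK Kq.
    rewrite mulrCA -zE; last exact: l_affine.
    by rewrite mulr_sumr; apply: eq_bigr => p _; rewrite mulrA.
  suff : 0 <= 2 * \sum_(q <- s) \sum_(p <- s) w q * w p * l q p by lra.
  rewrite mulr_natl mulr2n [X in _ + X]exchange_big/= -big_split/=.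
  rewrite big_seq sumr_ge0// => q /sK Kq.
  rewrite -big_split/= big_seq sumr_ge0// => p /sK Kp.
  rewrite (mulrC (w p)) -mulrDr mulr_ge0 ?l_mono// mulr_ge0//; exact: neg_ge0.
pose d q := l q z - l q x.
have wd : defect s x <= \sum_(q <- s) w q * d q.
  rewrite -subr_ge0 -sumrB (le_trans wz)// ler_sum// => q _.
  by rewrite /d mulrBr negM /w; lra.
apply: (@le_trans _ _ (\sum_(q <- s) (w q - t * d q) ^+ 2)).
  rewrite /defect big_seq [leRHS]big_seq ler_sum// => q /sK Kq.
  have -> : l q (t *: z + (1 - t) *: x) = l q x + t * d q.
    by rewrite l_affine// /d; ring.
  exact: negD.
have -> : \sum_(q <- s) (w q - t * d q) ^+ 2 = defect s x -
    2 * t * (\sum_(q <- s) w q * d q) + t ^+ 2 * \sum_(q <- s) (d q) ^+ 2.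
  rewrite !mulr_sumr -sumrB -big_split/=; apply: eq_bigr => q _.
  by rewrite /w; ring.
have /andP[t0 _] := t01.
rewrite lerD// ?ler_wpM2l ?sqr_ge0 ?sD// lerD2l lerN2 ler_wpM2l// mulr_ge0//.
Qed.

(* Frank-Wolfe steps decrease the sum of the squared violations as long as it
   stays away from 0: monotonicity makes the convex combination of [s] weighted
   by the violations a descent direction. *)
Lemma approximate_minty (s : seq V) (e : R) : (forall q, q \in s -> K q) ->
  0 < e -> exists2 x, K x & forall q, q \in s -> - e <= l q x.
Proof.
move=> sK e0; have [D HD] := oscillation_bound sK.
have [k0 Kk0] := K0.
have D0 : 0 <= D.
  by rewrite (le_trans _ (HD _ _ Kk0 Kk0))// sumr_ge0// => *; exact: sqr_ge0.
suff [x Kx xe] : exists2 x, K x & defect s x < e ^+ 2.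
  exists x => // q qs; rewrite -lerNl.
  have : neg (l q x) ^+ 2 < e ^+ 2.
    apply: le_lt_trans xe; rewrite /defect (big_rem q)//= lerDl.
    by rewrite sumr_ge0// => *; exact: sqr_ge0.
  rewrite ltr_sqr ?nnegrE ?neg_ge0 ?(ltW e0)//.
  rewrite gt_max => /andP[_ /ltW]; exact.
apply: contrapT => /forall2NP small.
have {}small x : K x -> e ^+ 2 <= defect s x.
  by move=> Kx; have [//|] := small x; rewrite leNgt => /negP.
pose S := defect s @` K.
have infS : has_inf S.
  split; first by exists (defect s k0), k0.
  by exists 0 => _ [x Kx <-]; rewrite (le_trans _ (small x Kx))// sqr_ge0.
(* With this [t], [t * D <= e ^+ 2 <= defect s x], so a step lowers the defect by at least
   [t * e ^+ 2]. Starting within that distance of the infimum, it lands below the infimum. *)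
pose t := e ^+ 2 / (e ^+ 2 + D).
have e2 : 0 < e ^+ 2 by rewrite exprn_gt0.
have eD : 0 < e ^+ 2 + D by lra.
have t0 : 0 < t by rewrite divr_gt0.
have t1 : t <= 1 by rewrite ler_pdivrMr// mul1r; lra.
have tD : t * D <= e ^+ 2.
  by rewrite mulrAC ler_pdivrMr// ler_wpM2l//; lra.
have [_ [x Kx <-] xinf] := inf_adherent (mulr_gt0 t0 e2) infS.
have [|y Ky] := defect_descent sK HD (t := t) Kx; first by rewrite ltW.
apply/negP; rewrite -ltNge.
have yinf : inf S <= defect s y by apply: ge_inf; [case: infS|exists y].
apply: lt_le_trans yinf; have := ler_wpM2l (ltW t0) tD.
have := ler_wpM2l (ltW t0) (small _ Kx); move: xinf; rewrite expr2; lra.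
Qed.

End approximate_minty.

(** * Minty's method for infinite systems of inequalities *)

Section monotone_variational_inequality.
Context {R : realType}.

(** The relaxed constraints [- e <= l q x] have the finite intersection property, so some
    ultrafilter contains them all; its limit satisfies each up to every [e]. *)
Lemma minty_solution (V : lmodType R) (K : set V) (l : V -> V -> R) :
  convex_set K -> K !=set0 -> (forall q, K q -> affine_on K (l q)) ->
  (forall q x, K q -> K x -> 0 <= l q x + l x q) ->
  (forall q, K q -> exists D : R, forall x, K x -> `|l q x| <= D) ->
  (forall F : set_system V, UltraFilter F -> F K ->
    exists2 p, K p & forall q, K q -> l q x @[x --> F] --> l q p) ->
  exists2 p, K p & forall q, K q -> 0 <= l q p.
Proof.
move=> cK K0 l_affine l_mono l_bounded l_compact.
pose D := [set i : V * R | K i.1 /\ 0 < i.2].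
pose f (i : V * R) := [set x | K x /\ - i.2 <= l i.1 x].
have finf : finI D f.
  move=> D' sD'D; have D'D i : i \in D' -> D i.
    by move=> iD'; apply: set_mem; exact: sD'D.
  (* A common tolerance: the least of finitely many, capped by 1. *)
  have [e e0 eD'] : exists2 e, 0 < e & forall i, i \in (D' : seq _) -> e <= i.2.
    have : forall i, i \in (D' : seq _) -> 0 < i.2 by move=> i /D'D[].
    elim: (D' : seq _) => [_|i s IH s0]; first by exists 1.
    have [|e e0 es] := IH; first by move=> j js; apply: s0; rewrite inE js orbT.
    exists (Num.min e i.2); first by rewrite lt_min e0 s0// mem_head.
    move=> j; rewrite inE ge_min => /predU1P[->|/es ->//].
    by rewrite lexx orbT.
  have [|x Kx xD'] := approximate_minty cK K0 l_affine l_mono l_bounded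
    (s := map fst D') (e := e) _ e0.
    by move=> _ /mapP[i /D'D[Ki _] ->].
  exists x => i /= iD'; split=> //.
  rewrite (le_trans _ (xD' _ (map_f _ iD')))//.
  by rewrite lerN2 eD'.
have [F [UF fF]] := ultraFilterLemma (finI_filter finf).
have Ff q e : K q -> 0 < e -> F (f (q, e)).
  by move=> Kq e0; apply: fF; exists (f (q, e)) => //; exact: finI_from1.
have FK : F K by have [k Kk] := K0; apply: filterS (Ff k 1 Kk ltr01) => x [].
have [p Kp lp] := l_compact F UF FK; exists p => // q Kq.
apply/ler_addgt0Pr => e e0; rewrite -lerBlDr sub0r.
by apply: cvgr_to_ge (lp q Kq) _; apply: filterS (Ff q e Kq e0) => x [].
Qed.

Lemma closed_norm_ball (V : normedModType R) (rho : R) :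
  closed [set x : V | `|x| <= rho].
Proof.
rewrite -[X in closed X]/((fun x : V => `|x|) @^-1` [set y | y <= rho]).
by apply: preimage_closed => [x _|]; [exact: norm_continuous|exact: closed_le].
Qed.

Lemma convex_norm_ball (V : normedModType R) (rho : R) :
  convex_set [set x : V | `|x| <= rho].
Proof.
move=> x y t; rewrite !inE/= => xr yr.
rewrite (le_trans (ler_normD _ _))// !normrZ !ger0_norm ?subr_ge0//.
have -> : rho = t%:num * rho + (1 - t%:num) * rho by ring.
by rewrite lerD// ler_wpM2l// subr_ge0.
Qed.

(** * The variational inequality on ball x [Lambda] *)

Section saddle_point.
Context {X Y : normedModType R}.
Hypothesis reflX : reflexive_space X.
Hypothesis reflY : reflexive_space Y.
Variables (B : X -> dual X) (b : X -> Y -> R) (Lambda : set Y) (rho : R).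
Hypothesis B_mono : forall u v, 0 <= (B v - B u) (v - u).
Hypothesis B_hemicont : forall u w,
  B (u + n.+1%:R^-1 *: w) w @[n --> \oo] --> B u w.
Hypothesis rho_gt0 : 0 < rho.
Hypothesis B_coercive : forall u, B u u <= 0 -> `|u| < rho.
Hypothesis b_duall : forall mu, b ^~ mu \in @is_dual R X.
Hypothesis b_dualr : forall v, b v \in @is_dual R Y.
Hypothesis Lambda_closed : closed Lambda.
Hypothesis Lambda_convex : convex_set Lambda.
Hypothesis Lambda_bounded : bounded_set Lambda.
Hypothesis Lambda0 : Lambda 0.

Let bl mu : dual X := Dual (b_duall mu).
Let br v : dual Y := Dual (b_dualr v).
Let K : set (X * Y) := [set p | `|p.1| <= rho /\ Lambda p.2].
(** The operator is evaluated at the test point [q], as in Minty's formulation, so that [l q] is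
    affine in [p]. *)
Let l (q p : X * Y) : R :=
  (B q.1 + bl q.2) (q.1 - p.1) - br q.1 (q.2 - p.2).

Let blDr v mu eta : b v (mu + eta) = b v mu + b v eta.
Proof. exact: (linearD (br v)). Qed.

Let blZr v t mu : b v (t *: mu) = t * b v mu.
Proof. by rewrite -[LHS]/(br v (t *: mu)) linearZ. Qed.

Let blDl v w mu : b (v + w) mu = b v mu + b w mu.
Proof. exact: (linearD (bl mu)). Qed.

Let blZl v t mu : b (t *: v) mu = t * b v mu.
Proof. by rewrite -[LHS]/(bl mu (t *: v)) linearZ. Qed.

Let blNr v mu : b v (- mu) = - b v mu.
Proof. exact: (linearN (br v)). Qed.

Let blNl v mu : b (- v) mu = - b v mu.
Proof. exact: (linearN (bl mu)). Qed.

Let K_convex : convex_set K.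
Proof.
move=> x y t /set_mem[x1 x2] /set_mem[y1 y2]; rewrite inE; split.
  have := @convex_norm_ball X rho x.1 y.1 t; rewrite !inE; exact.
have := @Lambda_convex x.2 y.2 t; rewrite !inE; exact.
Qed.

Let l_affine q : affine_on K (l q).
Proof.
move=> x y t _ _ _; rewrite /l; move: (B q.1 + bl q.2) (br q.1) => phi psi.
by rewrite /= !linearB/= !linearD/= !linearZ/= -![_ *: _]/(_ * _); ring.
Qed.

(** All terms in [b] cancel in the sum, which leaves the monotonicity of [B]. *)
Let l_mono q x : 0 <= l q x + l x q.
Proof.
have := B_mono x.1 q.1; rewrite /l dualDE -[(- B x.1) _]/(- B x.1 _).
rewrite !dualDE /=.
have -> : B x.1 (x.1 - q.1) = - B x.1 (q.1 - x.1).
  by rewrite -[x.1 - q.1]opprB linearN.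
rewrite !(blDl, blDr, blNl, blNr); lra.
Qed.

Let l_bounded q : exists D : R, forall x, K x -> `|l q x| <= D.
Proof.
(* [C] bounds [Lambda] only through numbers strictly above it, hence [C + 1]. *)
have [C [Creal LC]] := Lambda_bounded.
exists (`|B q.1 + bl q.2| * (`|q.1| + rho) + `|br q.1| * (`|q.2| + (C + 1))).
move=> x [x1 x2]; rewrite /l (le_trans (ler_normB _ _))// lerD//.
  rewrite (le_trans (dual_norm_le _ _))// ler_wpM2l ?dual_norm_ge0//.
  by rewrite (le_trans (ler_normB _ _))// lerD2l.
rewrite (le_trans (dual_norm_le _ _))// ler_wpM2l ?dual_norm_ge0//.
rewrite (le_trans (ler_normB _ _))// lerD2l.
by apply: (LC (C + 1)) => //; rewrite ltrDl.
Qed.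

Let l_compact (F : set_system (X * Y)) : UltraFilter F -> F K ->
  exists2 p, K p & forall q, K q -> l q x @[x --> F] --> l q p.
Proof.
move=> UF FK; have [C [Creal LC]] := Lambda_bounded.
have F1 : \forall p \near F, `|p.1| <= rho by apply: filterS FK => p [].
have F2 : \forall p \near F, Lambda p.2 by apply: filterS FK => p [].
have [u Fu] := reflexive_ultra_weak_cvg reflX UF F1.
have [|la Fla] := reflexive_ultra_weak_cvg (x := snd) (C := C + 1) reflY UF.
  by apply: filterS F2 => p /(LC (C + 1)); apply; rewrite ltrDl.
exists (u, la).
  split => /=.
    have clB := @closed_norm_ball X rho; have cB := @convex_norm_ball X rho.
    exact: closed_convex_weak_cvg clB cB F1 Fu.
  exact: closed_convex_weak_cvg Fla.
move=> q _; pose phi := B q.1 + bl q.2.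
have lE p : l q p = phi q.1 - phi p.1 - (br q.1 q.2 - br q.1 p.2).
  by rewrite -[RHS]/(phi _ - phi _ - (br q.1 _ - br q.1 _)) -!linearB.
rewrite lE; under eq_fun do rewrite lE.
by apply: cvgB; apply: cvgB; (exact: cvg_cst || exact: Fu || exact: Fla).
Qed.

(** Minty's trick: test at [p + t (q - p)], divide by [t], and let [t] tend to 0 through
    [1 / (n + 1)]. *)
Let vi_solution : exists2 p, K p & forall q, K q ->
  0 <= B p.1 (q.1 - p.1) + b (q.1 - p.1) p.2 - b p.1 (q.2 - p.2).
Proof.
have K0 : K !=set0 by exists 0; split; rewrite ?normr0 ?ltW.
have [p Kp pP] := minty_solution K_convex K0 (fun q _ => l_affine q)
  (fun q x _ _ => l_mono q x) (fun q _ => l_bounded q) l_compact.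
exists p => // q Kq; set w := q.1 - p.1; set e := q.2 - p.2.
(* The contribution of [b] after division by [t]; it is free of [t] because the quadratic terms
   cancel. *)
pose c := b w p.2 - b p.1 e.
have Bc : B (p.1 + n.+1%:R^-1 *: w) w + c @[n --> \oo] --> B p.1 w + c.
  by apply: cvgD; [exact: B_hemicont|exact: cvg_cst].
rewrite -addrA; apply: cvgr_to_ge Bc _; apply: nearW => n.
set t : R := n.+1%:R^-1.
have t0 : 0 < t by rewrite invr_gt0.
have t1 : 0 <= t <= 1 by rewrite ltW//= invf_le1 ?ler1n.
have := pP _ (convex_setP K_convex Kq Kp t1); rewrite /l.
have -> : (t *: q + (1 - t) *: p).1 = p.1 + t *: w.
  by rewrite /= /w scalerBr scalerBl scale1r addrCA.
have -> : (t *: q + (1 - t) *: p).2 = p.2 + t *: e.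
  by rewrite /= /e scalerBr scalerBl scale1r addrCA.
have -> : p.1 + t *: w - p.1 = t *: w by rewrite addrC addKr.
have -> : p.2 + t *: e - p.2 = t *: e by rewrite addrC addKr.
rewrite dualDE /= linearZ/=.
rewrite !(blDl, blDr, blZl, blZr) -[_ *: _]/(_ * _).
by move=> lq; rewrite -(pmulr_rge0 _ t0) /c !(blDl, blDr); lra.
Qed.

(** Coercivity puts [u] inside the open ball, so small steps in every direction [w] and [- w] are
    allowed and the first inequality becomes an equation. *)
Lemma saddle_point : exists u la, [/\ Lambda la,
  forall w, B u w + b w la = 0 & forall mu, Lambda mu -> b u (mu - la) <= 0].
Proof.
have [[u la] [/= ur Lla] uP] := vi_solution.
have u_lt : `|u| < rho.
  (* At the test point [(0, 0)] the terms in [b] cancel, which gives [B u u <= 0]. *)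
  have K00 : K (0, 0) by split; rewrite //= normr0 ltW.
  apply: B_coercive; have := uP _ K00.
  by rewrite /= !sub0r linearN/= blNl blNr; lra.
have ge0 w : 0 <= B u w + b w la.
  pose t := (rho - `|u|) / (`|w| + 1).
  have w0 : 0 < `|w| + 1 by rewrite ltr_wpDl.
  have t0 : 0 < t by rewrite divr_gt0// subr_gt0.
  have Kw : K (u + t *: w, la).
    split=> //=; rewrite (le_trans (ler_normD _ _))// -lerBrDl normrZ.
    rewrite gtr0_norm// /t mulrAC ler_pdivrMr//.
    by rewrite ler_wpM2l ?lerDl// subr_ge0 ltW.
  have -> : B u w + b w la = t^-1 * (t * B u w + t * b w la).
    by field; rewrite gt_eqF.
  have := uP _ Kw; rewrite /= (addrC u) addrK subrr linearZ/= blZl.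
  have -> : b u 0 = 0 by exact: (linear0 (br u)).
  by rewrite subr0 => tB; rewrite mulr_ge0// invr_ge0 ltW.
exists u, la; split=> // [w|mu Lmu].
  apply/eqP; rewrite eq_le ge0 andbT.
  by have := ge0 (- w); rewrite linearN/= blNl; lra.
have := uP (u, mu); rewrite /= subrr linear0 => /(_ (conj ur Lmu)).
have -> : b 0 la = 0 by exact: (linear0 (bl la)).
lra.
Qed.

End saddle_point.
End monotone_variational_inequality.

(** * Weak sequential continuity and upper limits *)

Section weak_continuity.
Context {R : realType} {V : normedModType R}.

Lemma cvg_weak_cvg (u_ : V^nat) (u : V) : u_ @ \oo --> u -> weak_cvg u_ u.
Proof. by move=> uu phi; apply: cvg_comp uu _; exact: dual_continuous. Qed.

Lemma cvg_shift_scale (u w : V) :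
  u + n.+1%:R^-1 *: w @[n --> \oo] --> u.
Proof.
rewrite -[X in _ --> X]addr0 -(scale0r w).
by apply: cvgD; [exact: cvg_cst|apply: cvgZr_tmp; exact: cvg_harmonic].
Qed.

(** If [g] were unbounded, vectors with [(n + 1) |x_n| < |g x_n|], divided by [g x_n], would tend to
    0 while [g] stays equal to 1 on them. *)
Lemma weakly_continuous_is_dual (g : V -> R) : linear g ->
  (forall (u_ : V^nat) u, weak_cvg u_ u -> g (u_ n) @[n --> \oo] --> g u) ->
  g \in @is_dual R V.
Proof.
move=> lg gcvg.
have [[C gC]|unb] := pselect (exists C, forall x, `|g x| <= C * `|x|).
  exact: bounded_is_dual lg gC.
pose G : {linear V -> R} := HB.pack g (GRing.isLinear.Build R V R *:%R g lg).
have /choice[x_ gx_] : forall n : nat, exists x, n.+1%:R * `|x| < `|g x|.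
  move=> n; apply: contrapT => /forallNP gn; apply: unb; exists n.+1%:R => x.
  by rewrite leNgt; exact/negP.
have gx_gt0 n : 0 < `|g (x_ n)| by apply: le_lt_trans (gx_ n); rewrite mulr_ge0.
have gx_neq0 n : g (x_ n) != 0 by rewrite -normr_gt0.
pose u_ n := (g (x_ n))^-1 *: x_ n.
have u0 : u_ @ \oo --> (0 : V).
  apply/cvgr0Pnorm_lt => e e0.
  have := @cvg_harmonic R => /cvgr0Pnorm_lt/(_ e e0); apply: filterS => n /=.
  apply: le_lt_trans; rewrite normrZ normfV (@ger0_norm _ n.+1%:R^-1)//.
  by rewrite ler_pdivrMl// ler_pdivlMr// mulrC ltW.
have := gcvg _ _ (cvg_weak_cvg u0).
have -> : g 0 = 0 by rewrite -[g]/(G : _ -> _) linear0.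
rewrite (_ : (fun n => g (u_ n)) = cst 1); last first.
  apply/funext => n; rewrite -[LHS]/(G (u_ n)) linearZ; exact: mulVf.
move=> /cvg_unique => /(_ (@norm_hausdorff _ _) 1 (cvg_cst _))/eqP.
by rewrite eq_sym oner_eq0.
Qed.

Lemma limn_esup_le_near (a : R^nat) (s e : R) :
  (limn_esup (fun n => (a n)%:E) <= s%:E)%E -> 0 < e ->
  \forall n \near \oo, a n < s + e.
Proof.
move=> as_ e0; have : (limn_esup (fun n => (a n)%:E) < (s + e)%:E)%E.
  by rewrite (le_lt_trans as_)// lte_fin ltrDl.
move=> /ereal_inf_lt[_ [W Woo <-] Wlt]; apply: filterS Woo => n Wn.
by rewrite -lte_fin (le_lt_trans _ Wlt)//; apply: ereal_sup_ubound; exists n.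
Qed.

(** The second bound says that the lower limit of [a] is at least [s]. *)
Lemma limn_esup_cvg (a : R^nat) (s : R) :
  (limn_esup (fun n => (a n)%:E) <= s%:E)%E ->
  (limn_esup (fun n => (- a n)%:E) <= (- s)%:E)%E -> a @ \oo --> s.
Proof.
move=> as_ Nas; apply/cvgrPdist_lt => e e0.
apply: filterS2 (limn_esup_le_near as_ e0) (limn_esup_le_near Nas e0) => n.
by rewrite ltr_distlC /=; lra.
Qed.

End weak_continuity.

(** For a nonzero [mu] every quotient would be 0, so the inner supremum, even over an empty set,
    would be at most 0. *)
Lemma infsup_inj (R : realType) (X Y : normedModType R) (b : X -> Y -> R)
    (alpha : R) (mu : Y) : 0 < alpha -> (alpha%:E <= infsup b)%E ->
  (forall v, b v mu = 0) -> mu = 0.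
Proof.
move=> alpha0 b_infsup bmu; apply/eqP; apply: contraPT alpha0 => mu0.
apply/negP; rewrite -leNgt -lee_fin (le_trans b_infsup)//.
apply: le_trans (ereal_inf_lbound _) _; first by exists mu.
by apply: ge_ereal_sup => _ [v _ <-]; rewrite bmu mul0r.
Qed.

(** * Odd sublinear functionals *)

Section odd_sublinear.
Context {R : realType} {V : normedModType R}.
Variables (g : V -> R) (c : R).
Hypothesis g_hom : forall v (t : R), 0 < t -> g (t *: v) = t * g v.
Hypothesis g_subadd : forall v w, g (v + w) <= g v + g w.
Hypothesis g_bound : forall v, `|g v| <= c * `|v|.
Hypothesis g_odd : forall v, g v + g (- v) <= 0.

(** Subadditivity and [g 0 = 0] reverse [g_odd], so [g] is odd; subadditivity at [- v] and [- w]
    then yields additivity. *)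
Lemma odd_sublinear_is_dual : g \in @is_dual R V.
Proof.
have g0 : g 0 = 0.
  by apply/eqP; rewrite -normr_le0 (le_trans (g_bound 0))// normr0 mulr0.
have gN v : g (- v) = - g v.
  by have := g_subadd v (- v); have := g_odd v; rewrite subrr g0; lra.
have gD v w : g (v + w) = g v + g w.
  apply/eqP; rewrite eq_le g_subadd/=.
  by have := g_subadd (- v) (- w); rewrite -opprD !gN; lra.
have gZ a v : g (a *: v) = a * g v.
  have [a0|a0|->] := ltgtP a 0; last by rewrite scale0r mul0r.
  - by rewrite -[a *: v]opprK -scaleNr gN g_hom ?oppr_gt0// mulNr opprK.
  - exact: g_hom.
by apply: bounded_is_dual g_bound => a v w; rewrite gD gZ.
Qed.

End odd_sublinear.

(** * Existence and uniqueness for Problem (P) *)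

Theorem theorem3 (R : realType) (X Y Z : completeNormedModType R)
  (A : X -> dual X) (b : X -> Y -> R) (J : X -> X -> R) (f : dual Z)
  (pi : X -> Z) (Lambda : set Y) (h : X -> R) (r alpha c M q m : R)
  (reflX : reflexive_space X) (reflY : reflexive_space Y)
  (reflZ : reflexive_space Z)
  (* (1) *)
  (r_gt1 : 1 < r)
  (h_hom : forall (t : R) (w : X), 0 < t -> h (t *: w) = t `^ r * h w)
  (A_mono : forall u v : X, (A v - A u) (v - u) >= h (v - u))
  (h_limsup : forall (u_ : X^nat) (u : X), weak_cvg u_ u ->
    ((h u)%:E <= limn_esup (fun n => (h (u_ n))%:E))%E)
  (* (2) *)
  (A_cont : continuous A)
  (* (3) *)
  (A_coercive : forall K : R, exists rho : R,
    forall u : X, rho < `|u| -> K < A u u / `|u|)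
  (* (4) *)
  (b_linearl : forall mu : Y, linear (fun v : X => b v mu))
  (b_linearr : forall v : X, linear (b v))
  (b_weakl : forall (u_ : X^nat) (u : X), weak_cvg u_ u ->
    forall mu : Y, b (u_ n) mu @[n --> \oo] --> b u mu)
  (b_weakr : forall (l_ : Y^nat) (l : Y), weak_cvg l_ l ->
    forall v : X, b v (l_ n) @[n --> \oo] --> b v l)
  (alpha_gt0 : 0 < alpha)
  (b_infsup : (alpha%:E <= infsup b)%E)
  (* (5) *)
  (J_hom : forall (u v : X) (t : R), 0 < t -> J u (t *: v) = t * J u v)
  (J_subadd : forall u v w : X, J u (v + w) <= J u v + J u w)
  (c_gt0 : 0 < c)
  (J_bound : forall u v : X, `|J u v| <= c * `|v|)
  (J_limsup : forall (u_ v_ : X^nat) (u v : X),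
    weak_cvg u_ u -> weak_cvg v_ v ->
    (limn_esup (fun n => (J (u_ n) (v_ n))%:E) <= (J u v)%:E)%E)
  (* (6) *)
  (Lambda_closed : closed Lambda)
  (Lambda_convex : convex_set Lambda)
  (Lambda_bounded : bounded_set Lambda)
  (Lambda0 : Lambda 0)
  (* (7) *)
  (pi_linear : linear pi)
  (pi_cont : continuous pi)
  (* (8) *)
  (M_gt0 : 0 < M)
  (q_ge2 : 2 <= q)
  (h_lower : forall v : X, h v >= M * `|v| `^ q)
  (* (9) *)
  (m_ge0 : 0 <= m)
  (J_relaxed : forall w1 w2 : X,
    J w1 (w2 - w1) + J w2 (w1 - w2) <= m * `|w1 - w2| `^ q)
  (* (10) *)
  (m_lt_M : m < M)
  (* (11) *)
  (J_odd : forall u v : X, J u v + J u (- v) <= 0) :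
  exists! p : X * Y, solves_P A b J f pi Lambda p.1 p.2.
Proof.
have J_dual u : J u \in @is_dual R X.
  exact: odd_sublinear_is_dual (J_hom u) (J_subadd u) (J_bound u) (J_odd u).
have b_duall mu : b ^~ mu \in @is_dual R X.
  apply: (weakly_continuous_is_dual (b_linearl mu)) => u_ u uu; exact: b_weakl.
have b_dualr v : b v \in @is_dual R Y.
  apply: (weakly_continuous_is_dual (b_linearr v)) => l_ la ll; exact: b_weakr.
have fpi_dual : f \o pi \in @is_dual R X.
  rewrite inE; split=> [a x y|x].
    by rewrite /= pi_linear linearP.
  by apply: continuous_comp; [exact: pi_cont|exact: dual_continuous].
pose Jd u : dual X := Dual (J_dual u).
pose g : dual X := Dual fpi_dual.
pose bl mu : dual X := Dual (b_duall mu).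
pose br v : dual Y := Dual (b_dualr v).
pose B u : dual X := A u + Jd u - g.
have BE u w : B u w = A u w + J u w - f (pi w) by [].
(* Since [J v] is linear, (9) bounds [J v (v - u) - J u (v - u)] below by [- m |v - u|^q], and (1)
   with (8) supplies [M |v - u|^q]. *)
have B_strong u v : (M - m) * `|v - u| `^ q <= (B v - B u) (v - u).
  have -> : (B v - B u) (v - u) =
      (A v - A u) (v - u) + (J v (v - u) - J u (v - u)).
    rewrite -[LHS]/(B v _ - B u _) !BE -[(A v - A u) _]/(A v _ - A u _).
    by ring.
  have := J_relaxed v u; rewrite -[u - v]opprB.
  have -> : J v (- (v - u)) = - J v (v - u) by rewrite -[LHS]/(Jd v _) linearN.
  have := A_mono u v; have := h_lower (v - u); lra.
have B_mono u v : 0 <= (B v - B u) (v - u).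
  by apply: le_trans (B_strong u v); rewrite mulr_ge0 ?powR_ge0// subr_ge0 ltW.
have B_hemicont u w : B (u + n.+1%:R^-1 *: w) w @[n --> \oo] --> B u w.
  have uw := @cvg_shift_scale _ _ u w; have uw_weak := cvg_weak_cvg uw.
  suff [Auw Juw] : A (u + n.+1%:R^-1 *: w) w @[n --> \oo] --> A u w /\
      J (u + n.+1%:R^-1 *: w) w @[n --> \oo] --> J u w.
    by apply: cvgB; [apply: cvgD Juw|exact: cvg_cst].
  split.
    apply: (@cvg_comp _ _ _ _ (fun v => A v w) _ _ _ uw).
    apply: (@continuous_comp _ _ _ A (bidual_embed w) u); first exact: A_cont.
    exact: dual_continuous.
  (* The upper limit condition in (5), used in the directions [w] and [- w], bounds [J] from both
     sides. *)
  have cst_weak (v : X) : weak_cvg (fun=> v) v.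
    by apply: cvg_weak_cvg; exact: cvg_cst.
  apply: limn_esup_cvg; first exact: (J_limsup _ _ _ _ uw_weak (cst_weak w)).
  have := J_limsup _ _ _ _ uw_weak (cst_weak (- w)).
  rewrite -[J u (- w)]/(Jd u _) linearN.
  by under eq_fun do rewrite -[J _ (- w)]/(Jd _ _) linearN.
(* [B u u <= 0] forces [A u u <= (|g| + c) |u|]. The radius exceeds both [rho0] and 0, so (3)
   applies to any [u] outside the ball, with nonzero norm. *)
have [rho0 Arho0] := A_coercive (`|g| + c).
have rho_gt0 : 0 < Num.max rho0 0 + 1 by rewrite ltr_wpDl// le_max lexx orbT.
have B_coercive u : B u u <= 0 -> `|u| < Num.max rho0 0 + 1.
  rewrite BE => Bu; rewrite ltNge; apply/negP => rho_u.
  have rho0_u : Num.max rho0 0 < `|u|.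
    by apply: lt_le_trans rho_u; rewrite ltrDl.
  have u0 : 0 < `|u| by apply: le_lt_trans rho0_u; rewrite le_max lexx orbT.
  have : `|g| + c < A u u / `|u|.
    by apply: Arho0; apply: le_lt_trans rho0_u; rewrite le_max lexx.
  rewrite ltr_pdivlMr// mulrDl ltNge => /negP; apply.
  have := le_trans (ler_norm _) (dual_norm_le g u); rewrite -dual_normE /=.
  have := J_bound u u; rewrite ler_norml => /andP[+ _]; lra.
have [u [la [Lla Bu bu]]] := saddle_point reflX reflY B_mono B_hemicont rho_gt0
  B_coercive b_duall b_dualr Lambda_closed Lambda_convex Lambda_bounded Lambda0.
(* Testing with [v = u' + w] gives an inequality linear in [w], hence an equation. *)
have solves_eq u' la' : solves_P A b J f pi Lambda u' la' ->
    forall w, B u' w + b w la' = 0.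
  move=> [_ + _]; move=> uE.
  have ge0 w : 0 <= B u' w + b w la'.
    by have := uE (u' + w); rewrite addrC addKr BE; lra.
  move=> w; apply/eqP; rewrite eq_le ge0 andbT.
  have := ge0 (- w); rewrite linearN/=.
  have -> : b (- w) la' = - b w la' by rewrite -[LHS]/(bl _ _) linearN.
  lra.
have sol : solves_P A b J f pi Lambda u la.
  by split=> // v; have := Bu (v - u); rewrite BE; lra.
exists (u, la); split=> //= -[u' la'] /= sol'.
have Bu' := solves_eq _ _ sol'; case: sol' => Lla' _ bu'.
(* Both equations at [u' - u], with each multiplier tested against the other, give
   [(B u' - B u) (u' - u) <= 0], against strong monotonicity. *)
have uu' : u = u'.
  apply/eqP; rewrite eq_sym -subr_eq0 -normr_eq0; apply: contraT => d0.
  have d_gt0 : 0 < `|u' - u| `^ q by rewrite powR_gt0// lt_def d0 normr_ge0.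
  have : 0 < (B u' - B u) (u' - u).
    by apply: lt_le_trans (B_strong u u'); rewrite mulr_gt0// subr_gt0.
  have := bu la' Lla'; have := bu' la Lla.
  have := Bu (u' - u); have := Bu' (u' - u).
  rewrite -[(B u' - B u) _]/(B u' _ - B u _).
  rewrite -![b _ (_ - _)]/(br _ _) !linearB/=.
  rewrite -![b (_ - _) _]/(bl _ _) !linearB/=; lra.
(* With equal [u], subtracting the equations shows that [b v (la - la')] vanishes for all [v]. *)
congr pair => //; rewrite -uu' in Bu'; apply/eqP; rewrite -subr_eq0; apply/eqP.
apply: (infsup_inj alpha_gt0 b_infsup) => v.
rewrite -[b _ _]/(br _ _) linearB/=.
by have := Bu v; have := Bu' v; lra.
Qed.
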